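(* Let $M$ be a discrete countable monoid and $X$ a dynamical $M$-system. The following are equivalent: (1) $X$ is expansive; (2) $X$ is subshift/SFT, i.e. $X\cong Y/Z$ for some subshift $Y\subset\Sigma^M$ and some SFT $Z\subset(\Sigma^2)^M$ ($\Sigma$ a finite alphabet) such that $Z\cap Y^2$ is an equivalence relation on $Y$; (3) $X$ is conjugate to $Y/Z$ for some subshifts $Y\subset\Sigma^M$, $Z\subset(\Sigma^2)^M$, and whenever $X\cong Y/Z$ with $Y\subset \Sigma^M$ and $Z\subset(\Sigma^2)^M$ subshifts (for some finite alphabet $\Sigma$, with $Z\cap Y^2$ an equivalence relation on $Y$), the set $Z\cap Y^2$ is a relative SFT in $Y^2$. If moreover $M$ is a group, then (1)--(3) are also equivalent to: (4) $X$ is conjugate to $Y/Z$ for a subshift $Y$ and a relative SFT equivalence relation $Z\subset Y^2$ such that the set $\{y\in Y : \exists y'\in Y\setminus\{y\},\ (y,y')\in Z\}$ is meager in $Y$.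
   Context: Let $M$ be a discrete monoid. A dynamical $M$-system is a left action of $M$ by continuous maps on a compact metrizable space ($1_M$ acts as the identity and $(mn)x=m(nx)$). Two systems are conjugate ($\cong$) if there is an $M$-equivariant homeomorphism between them. A system $X$ is expansive if for some compatible metric $d$ and some $\epsilon>0$, for all distinct $x,y\in X$ there is $m\in M$ with $d(mx,my)>\epsilon$. For a finite alphabet $\Sigma$, $M$ acts on $\Sigma^M$ (product topology) by $(mx)_n=x_{nm}$. A subshift is a topologically closed $M$-invariant subset of $\Sigma^M$. A subshift $X\subset\Sigma^M$ is an SFT if there is a clopen set $C\subset\Sigma^M$ such that $x\in X\iff \forall m\in M:\ mx\notin C$. We identify $(A\times B)^M$ with $A^M\times B^M$ (diagonal action), so subshifts over $\Sigma^2$ are viewed as relations on $\Sigma^M$. For a subshift $Y\subset\Sigma^M$ and a subshift $Z\subset(\Sigma^2)^M$ such that $Z\cap Y^2$ is an equivalence relation on $Y$, $Y/Z$ denotes the topological quotient $Y/(Z\cap Y^2)$ with the action $m[y]=[my]$. A subset of $Y^2$ is a relative SFT in $Y^2$ if it equals $Z'\cap Y^2$ for some SFT $Z'\subset(\Sigma^2)^M$. *)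

(* Defs.v *)
From HB Require Import structures.
From mathcomp Require Import all_boot all_order all_algebra.
From mathcomp Require Import all_classical reals topology.
From Corelib Require RelationClasses.

Set Implicit Arguments.
Unset Strict Implicit.
Unset Printing Implicit Defensive.

Import Order.TTheory GRing.Theory Num.Theory.

Local Open Scope ring_scope.
Local Open Scope classical_set_scope.
Local Open Scope quotient_scope.

Record is_metric (R : realType) (X : Type) (d : X -> X -> R) : Prop := {
  metric_xx : forall x, d x x = 0;
  metric_positivity : forall x y, d x y = 0 -> x = y;
  metric_symmetric : forall x y, d x y = d y x;
  metric_triangular : forall y x z, d x z <= d x y + d y z
}.

Definition compatible_metric (R : realType) (X : topologicalType)
    (d : X -> X -> R) : Prop :=
  is_metric d /\
  forall x : X, nbhs x = filter_from [set e : R | 0 < e]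
                                     (fun e => [set y | d x y < e]).

Definition nowhere_dense (T : topologicalType) (A : set T) : Prop :=
  interior (closure A) = set0.

Definition meager (T : topologicalType) (A : set T) : Prop :=
  exists2 F : nat -> set T,
    (forall n, nowhere_dense (F n)) & A = \bigcup_n F n.

Definition is_group (M : monoidType) : Prop :=
  forall m : M, exists m' : M, (m * m' = 1)%g /\ (m' * m = 1)%g.

Record dynamical_system (R : realType) (M : monoidType) (X : topologicalType)
    (act : M -> X -> X) : Prop := {
  ds_compact : compact [set: X];
  ds_metrizable : exists d : X -> X -> R, compatible_metric d;
  ds_act1 : forall x, act 1%g x = x;
  ds_actM : forall m n x, act (m * n)%g x = act m (act n x);
  ds_continuous : forall m, continuous (act m)
}.

Definition expansive (R : realType) (M : monoidType) (X : topologicalType)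
    (act : M -> X -> X) : Prop :=
  exists2 d : X -> X -> R, compatible_metric d &
  exists2 e : R, 0 < e &
  forall x y : X, x <> y -> exists m : M, e < d (act m x) (act m y).

Definition conjugate (M : monoidType) (X X' : topologicalType)
    (act : M -> X -> X) (act' : M -> X' -> X') : Prop :=
  exists (h : X -> X') (g : X' -> X),
    [/\ cancel h g, cancel g h, continuous h, continuous g &
        forall m x, h (act m x) = act' m (h x)].

Definition config (M : monoidType) (S : finType) : topologicalType :=
  prod_topology (fun _ : M => discrete_topology S).

Definition shift_act (M : monoidType) (S : finType) (m : M) (x : config M S) :
  config M S := fun n => x (n * m)%g.

Record subshift (M : monoidType) (S : finType) := Subshift {
  subshift_set :> set (config M S);
  subshift_closed : closed subshift_set;
  subshift_invariant :
    forall m x, subshift_set x -> subshift_set (shift_act m x)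
}.

Definition SFT (M : monoidType) (S : finType) (X : subshift M S) : Prop :=
  exists2 C : set (config M S), clopen C &
  forall x : config M S, subshift_set X x <-> forall m : M, ~ C (shift_act m x).

Definition pair_config (M : monoidType) (S : finType) (x y : config M S) :
  config M (S * S)%type := fun m => (x m, y m).

(* [Y^2], under the identification of [(S * S)^M] with [S^M * S^M] *)
Definition square (M : monoidType) (S : finType) (Y : set (config M S)) :
  set (config M (S * S)%type) :=
  [set p | Y (fun m => (p m).1) /\ Y (fun m => (p m).2)].

Definition relative_SFT (M : monoidType) (S : finType) (Y : subshift M S)
    (W : set (config M (S * S)%type)) : Prop :=
  exists2 Z : subshift M (S * S)%type, SFT Z & W = Z `&` square Y.

Section Quotient.
Variables (M : monoidType) (S : finType).
Variables (Y : subshift M S) (Z : subshift M (S * S)%type).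

(* [Z `&` square Y], as a relation on the subspace [Y] *)
Definition rel_in (y y' : Y) : Prop :=
  subshift_set Z (pair_config (val y) (val y')).

Lemma subshift_act_subproof (m : M) (y : Y) :
  shift_act m (val y) \in (Y : set (config M S)).
Proof. by apply/mem_set/subshift_invariant/set_valP. Qed.

Definition subshift_act (m : M) (y : Y) : Y :=
  SigSub (subshift_act_subproof m y).

Hypothesis eqZ : RelationClasses.Equivalence rel_in.

Definition relb_in (y y' : Y) : bool := `[< rel_in y y' >].

Lemma relb_in_refl : reflexive relb_in.
Proof. by case: eqZ => r _ _ y; apply/asboolP/r. Qed.

Lemma relb_in_sym : symmetric relb_in.
Proof. by case: eqZ => _ s _ y y'; apply/asboolP/asboolP => /s. Qed.

Lemma relb_in_trans : transitive relb_in.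
Proof.
case: eqZ => _ _ t y x z /asboolP xy /asboolP yz.
by apply/asboolP; exact: t xy yz.
Qed.

Definition equiv_in : equiv_rel Y :=
  EquivRel relb_in relb_in_refl relb_in_sym relb_in_trans.

Definition quotient_space : topologicalType :=
  quotient_topology {eq_quot equiv_in}.

Definition quotient_class (y : Y) : quotient_space := \pi_{eq_quot equiv_in} y.

(* Defined through representatives; independent of them by [quotient_actE]. *)
Definition quotient_act (m : M) (q : quotient_space) : quotient_space :=
  quotient_class (subshift_act m (repr (q : {eq_quot equiv_in}))).

Lemma quotient_classP (y y' : Y) :
  quotient_class y = quotient_class y' <-> rel_in y y'.
Proof.
split=> [/eqmodP/asboolP//|yy']; apply/eqmodP; exact/asboolP.
Qed.

Lemma quotient_actE (m : M) (y : Y) :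
  quotient_act m (quotient_class y) = quotient_class (subshift_act m y).
Proof.
apply/quotient_classP; rewrite /rel_in /=.
have yy' : rel_in (repr (\pi_{eq_quot equiv_in} y)) y.
  by apply/quotient_classP; rewrite /quotient_class reprK.
exact: (@subshift_invariant _ _ Z m _ yy').
Qed.

End Quotient.

Arguments rel_in {M S} Y Z.
Arguments quotient_act {M S Y Z}.

Definition conjugate_to_quotient (M : monoidType) (X : topologicalType)
    (act : M -> X -> X) (S : finType) (Y : subshift M S)
    (Z : subshift M (S * S)%type) : Prop :=
  exists eqZ : RelationClasses.Equivalence (rel_in Y Z),
    conjugate act (quotient_act eqZ).

(* Main.v *)
Require Import Defs.
From mathcomp Require Import all_boot all_order all_algebra.
From mathcomp Require Import all_classical reals topology.
From mathcomp Require Import lra.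

(** By compactness, [X] is conjugate to the quotient of [Y] by [Z] if and only if
    there is a continuous equivariant surjection [pi] from [Y] onto [X] whose kernel
    is the relation that [Z] induces on [Y] ([conjugate_to_quotientP]). For such a
    [pi], [X] is expansive if and only if the kernel is a relative SFT.

    If the kernel is cut out by a clopen set [C] of forbidden pairs, then the images
    of the pairs in [C] stay at a distance bounded away from 0, which gives an
    expansivity constant ([expansive_of_relative_SFT]). Conversely, if [e] is an
    expansivity constant, a clopen set [C] separating the pairs with images at
    distance at least [e] from the kernel is a set of forbidden pairs
    ([relative_SFT_of_expansivity_constant]).

    It remains to code an expansive [X]. Take a finite family of disjoint open sets
    [U a] with dense union, so small that points of two closures that meet are at
    distance at most the expansivity constant ([small_open_tiling]). Let [y] code [x]
    when [act m x] lies in the closure of [U (y m)] for all [m]. The codes form a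
    subshift, a code determines its point, and two configurations code the same point
    exactly when the closures of their tiles meet at every [m]: an SFT condition
    ([expansive_subshift_SFT]).

    When [M] is a group, the points whose orbit stays in the open tiles are dense, by
    Baire's theorem, and have a single code. The closure of the set of these codes
    still covers [X], and the set of its points that share their image with another
    point is meager ([group_expansive_meager]). *)

Set Implicit Arguments.
Unset Strict Implicit.
Unset Printing Implicit Defensive.

Import Order.TTheory GRing.Theory Num.Theory.
Local Open Scope classical_set_scope.
Local Open Scope ring_scope.
Local Open Scope quotient_scope.

(** * Compatible metrics and compact spaces *)

Section MetricFacts.
Variables (R : realType) (X : topologicalType) (d : X -> X -> R).
Hypothesis cd : compatible_metric d.

Let d_metric : is_metric d. Proof. by case: cd. Qed.

Lemma metric_ge0 x y : 0 <= d x y.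
Proof.
have := metric_triangular d_metric y x x.
rewrite (metric_xx d_metric) (metric_symmetric d_metric y x); lra.
Qed.

Lemma metric_nbhsP x (A : set X) :
  nbhs x A <-> exists2 e : R, 0 < e & [set y | d x y < e] `<=` A.
Proof. by case: cd => _ ->. Qed.

Lemma metric_ball_nbhs x (e : R) : 0 < e -> nbhs x [set y | d x y < e].
Proof. by move=> e0; apply/metric_nbhsP; exists e. Qed.

Lemma metric_ball_open x (e : R) : open [set y | d x y < e].
Proof.
rewrite openE => y /= dxy; apply/metric_nbhsP; exists (e - d x y).
  by rewrite subr_gt0.
move=> z /= dyz; have := metric_triangular d_metric y x z; lra.
Qed.

Lemma metric_gt_open x (e : R) : open [set y | e < d x y].
Proof.
rewrite openE => y /= dxy; apply/metric_nbhsP; exists (d x y - e).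
  by rewrite subr_gt0.
move=> z /= dyz; have := metric_triangular d_metric z x y.
rewrite (metric_symmetric d_metric z y); lra.
Qed.

Lemma metric_closed_ball_closed x (e : R) : closed [set y | d x y <= e].
Proof.
rewrite -openC (_ : ~` _ = [set y | e < d x y]); first exact: metric_gt_open.
by apply/seteqP; split=> y /=; rewrite ltNge => /negP.
Qed.

Lemma metric_hausdorff : hausdorff_space X.
Proof.
move=> x y xy; apply/(metric_positivity d_metric)/eqP.
rewrite eq_le metric_ge0 andbT; apply/ler_addgt0Pr => e e0; rewrite add0r.
have e2 : 0 < e / 2 by rewrite divr_gt0.
have [z [/= dxz dyz]] := xy _ _ (metric_ball_nbhs x e2) (metric_ball_nbhs y e2).
have := metric_triangular d_metric z x y.
by rewrite (metric_symmetric d_metric z y); lra.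
Qed.

(** A compatible metric is continuous in both arguments jointly. *)
Lemma metric_near (e : R) x y : 0 < e ->
  \forall x' \near x & y' \near y, `|d x' y' - d x y| < e.
Proof.
move=> e0; have e2 : 0 < e / 2 by rewrite divr_gt0.
exists ([set x' | d x x' < e / 2], [set y' | d y y' < e / 2]).
  by split; exact: metric_ball_nbhs.
move=> [x' y'] [/= dx dy].
have := metric_triangular d_metric x' x y.
have := metric_triangular d_metric y' x' y.
have := metric_triangular d_metric x x' y'.
have := metric_triangular d_metric y x y'.
rewrite (metric_symmetric d_metric y' y) (metric_symmetric d_metric x' x).
rewrite ltr_norml => *; apply/andP; split; lra.
Qed.

Lemma compact_finite_balls (e : R) : compact [set: X] -> 0 < e ->
  exists s : seq X, forall x, exists2 c, c \in s & d c x < e.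
Proof.
move=> /compact_near_coveringP cX e0.
(* Finite families of centres, directed by inclusion. *)
pose F : set_system (seq X) :=
  filter_from setT (fun s : seq X => [set t : seq X | {subset s <= t}]).
have FF : Filter F.
  apply: filter_from_filter; first by exists [::].
  move=> s t _ _; exists (s ++ t) => // u stu.
  by split=> x xs; apply: stu; rewrite mem_cat xs ?orbT.
have [|s _ sP] := cX _ F (fun s x => exists2 c, c \in s & d c x < e) FF.
  move=> x _; exists ([set y | d x y < e], [set t : seq X | {subset [:: x] <= t}]).
    by split; [exact: metric_ball_nbhs|exists [:: x]].
  by move=> [y t] [/= xy xt]; exists x => //; apply: xt; rewrite inE.
by exists s => x; exact: (sP s).
Qed.

End MetricFacts.

(** The Baire category theorem for compact metrizable spaces. *)
Lemma compact_metric_Baire (R : realType) (X : topologicalType)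
    (d : X -> X -> R) (U : nat -> set X) :
    compatible_metric d -> compact [set: X] ->
    (forall n, open (U n)) -> (forall n, dense (U n)) ->
  dense (\bigcap_n U n).
Proof.
move=> cd cX oU dU O O0 oO.
(* Pairs of an index [n] and a nonempty open set [A], each followed by [n.+1]
   and a ball whose closure lies in [A] and in [U n]. *)
pose T := {A : set X | open A /\ A !=set0}.
have step (a : nat * T) : exists b : nat * T, b.1 = a.1.+1 /\
    closure (sval b.2) `<=` sval a.2 `&` U a.1.
  case: a => n [A [oA A0]] /=.
  have [x Ux] := dU n _ A0 oA.
  have /(metric_nbhsP cd)[e e0 eA] : nbhs x (A `&` U n).
    by apply: open_nbhs_nbhs; split=> //; exact: openI.
  have B0 : [set y | d x y < e / 2] !=set0.
    by exists x; rewrite /= (metric_xx cd.1) divr_gt0.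
  exists (n.+1, exist _ [set y | d x y < e / 2]
    (conj (metric_ball_open cd x (e / 2)) B0)); split=> //= y.
  move=> /(closureS (B := [set y | d x y <= e / 2])).
  have -> : closure [set y | d x y <= e / 2] = [set y | d x y <= e / 2].
    by apply/esym/closure_id; exact: metric_closed_ball_closed.
  move=> yB; apply: eA => /=; apply: (le_lt_trans (yB _)); last by lra.
  by move=> z /= /ltW.
have [f [f0 fS]] := dependent_choice (fun a => cid (step a))
  (0%N, exist _ O (conj oO O0)).
pose C n := sval (f n).2.
have fn n : (f n).1 = n by elim: n => [|n IH]; rewrite ?f0// (fS n).1 IH.
have CS n : closure (C n.+1) `<=` C n `&` U n.
  by have := (fS n).2; rewrite fn.
have Cmono m n : (m <= n)%N -> C n `<=` C m.
  elim: n => [|n IH]; first by rewrite leqn0 => /eqP ->.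
  rewrite leq_eqVlt ltnS => /predU1P[->//|/IH nm] x.
  by move=> /subset_closure/CS[/nm].
suff [x Cx] : (\bigcap_n C n) !=set0.
  exists x; split; first by have := Cx 0%N I; rewrite /C f0.
  by move=> n _; have /subset_closure/CS[] := Cx n.+1 I.
apply: contrapT => C0.
have [|n _ nP] := (compact_near_coveringP _).1 cX _ \oo
    (fun n x => ~ C n x) _.
  move=> x _; have [n nCx] : exists n, ~ closure (C n) x.
    apply: contrapT => Cx; apply: C0; exists x => n _.
    suff /CS[] : closure (C n.+1) x by [].
    by apply: contrapT => ?; apply: Cx; exists n.+1.
  exists (~` closure (C n), [set m | (n <= m)%N]).
    split; last by exists n.
    apply: open_nbhs_nbhs; split=> //; apply/closed_openC/closed_closure.
  by move=> [y m] [/= nCy nm] /(Cmono _ _ nm)/subset_closure.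
have [x Cx] := (svalP (f n).2).2.
by apply: (nP n _ x) => //=.
Qed.

Section CompactHausdorff.

(** The tube lemma. *)
Lemma compact_near_all (T U : topologicalType) (A : set T) (u : U)
    (P : U -> T -> Prop) :
    compact A ->
    (forall t, A t -> \forall t' \near t & u' \near u, P u' t') ->
  \forall u' \near u, forall t, A t -> P u' t.
Proof.
by move=> /compact_near_coveringP cA AP; exact: (cA U (nbhs u) P _ AP).
Qed.

Lemma compact_set_type (T : topologicalType) (A : set T) :
  compact A -> compact [set: A].
Proof.
move=> cA F PF _.
have [|x [Ax Fx]] := cA (val @ F) _; first by apply: nearW => a; exact: set_valP.
exists (SigSub (mem_set Ax)); split=> // B V FB [_ [[W oW <-] /= Wx WV]].
have [z [[a Ba <-] Wz]] : (val @` B) `&` W !=set0.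
  apply: Fx; last exact: open_nbhs_nbhs.
  by apply: (@filterS _ F _ B) FB => b Bb; exists b.
by exists a; split=> //; exact: WV.
Qed.

Lemma compact_hausdorff_inverse_continuous (T U : topologicalType)
    (f : T -> U) (g : U -> T) :
  compact [set: T] -> hausdorff_space U -> continuous f ->
  cancel f g -> cancel g f -> continuous g.
Proof.
move=> cT hU cf fK gK; apply/continuous_closedP => A clA.
have -> : g @^-1` A = f @` A.
  by apply/seteqP; split=> [u Agu|_ [t At <-] /=]; [exists (g u)|rewrite fK].
apply: compact_closed => //; apply: continuous_compact.
  by apply: continuous_subspaceT.
exact: subclosed_compact cT _.
Qed.

(** In a zero-dimensional compact Hausdorff space, clopen sets separate a compact
    set from any closed set disjoint from it. *)
Lemma clopen_separation (T : topologicalType) (A U : set T) :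
  hausdorff_space T -> zero_dimensional T -> compact [set: T] ->
  compact A -> open U -> A `<=` U ->
  exists2 C, clopen C & A `<=` C /\ C `<=` U.
Proof.
move=> hT zT cT /compact_near_coveringP cA oU AU.
(* Clopen subsets of [U], directed by inclusion: each point of [A] lies in all
   large enough ones, hence so does the whole of [A]. *)
pose D := [set C : set T | clopen C /\ C `<=` U].
pose F := filter_from D (fun C => [set C' | D C' /\ C `<=` C']).
have FF : Filter F.
  apply: filter_from_filter; first exists set0.
    by split; [exact: clopen0|exact: sub0set].
  move=> B C [cB BU] [cC CU]; exists (B `|` C).
    by split; [exact: clopenU|rewrite subUset].
  by move=> E [DE]; rewrite subUset => -[? ?].
have [|C [cC CU] CP] := cA _ F (fun C x => C x) FF; last first.
  by exists C => //; split=> //; apply: (CP C); split.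
move=> x Ax; have [C [Cx cC] CU] :
    filter_from [set D : set T | D x /\ clopen D] id U.
  apply: zero_dimensional_cvg => //; apply: open_nbhs_nbhs.
  by split=> //; exact: AU.
exists (C, [set C' | D C' /\ C `<=` C']).
  by split; [apply: open_nbhs_nbhs; split=> //; case: cC|exists C].
by move=> [y C'] [/= Cy [_]]; apply.
Qed.

End CompactHausdorff.

(** * Configurations, subshifts and subshifts of finite type *)

Section Config.
Variables (M : monoidType) (S : finType).
Implicit Types x y : config M S.

Lemma config_compact : compact [set: config M S].
Proof.
have -> : [set: config M S] =
    [set f : forall _ : M, discrete_topology S | forall m, setT (f m)].
  by apply/seteqP.
apply: (@tychonoff M (fun=> discrete_topology S) (fun=> setT)) => m.
by apply: finite_compact; exact: finite_finset.
Qed.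

Lemma config_hausdorff : hausdorff_space (config M S).
Proof. by apply: hausdorff_product => m; exact: discrete_hausdorff. Qed.

Lemma config_zero_dimensional : zero_dimensional (config M S).
Proof. by apply: zero_dimension_prod => m; exact: discrete_zero_dimension. Qed.

Lemma config_coord_clopen (P : set S) m : clopen [set x : config M S | P (x m)].
Proof.
have cP : clopen (P : set (discrete_topology S)).
  by split; [exact: discrete_open|exact: discrete_closed].
have cm : continuous (fun x : config M S => x m : discrete_topology S).
  exact: (@proj_continuous M (fun=> discrete_topology S) m).
exact: (preimage_clopen cP cm).
Qed.

Lemma config_coord_nbhs x m : nbhs x [set y : config M S | y m = x m].
Proof.
apply: open_nbhs_nbhs; split=> //.
by have [] := config_coord_clopen [set a | a = x m] m.
Qed.

(** The coordinates take values in a discrete space, so continuity of a map into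
    configurations means that every coordinate is locally constant. *)
Lemma config_continuous (T : topologicalType) (f : T -> config M S) :
  (forall m t, nbhs t [set u | f u m = f t m]) -> continuous f.
Proof.
move=> fc t; apply/cvg_sup => m U [_ [[W oW <-] /= Wf WU]].
by apply: filterS (fc m t) => u /= fu; apply: WU => /=; rewrite fu.
Qed.

Lemma shift_act1 x : shift_act 1%g x = x.
Proof. by apply/funext => n; rewrite /shift_act mulg1. Qed.

Lemma shift_actM m n x : shift_act (m * n)%g x = shift_act m (shift_act n x).
Proof. by apply/funext => k; rewrite /shift_act mulgA. Qed.

Lemma shift_act_continuous m : continuous (@shift_act M S m).
Proof. by apply: config_continuous => n x; exact: config_coord_nbhs. Qed.

(** The configurations no translate of which meets [C]: the subshift of finite
    type that a clopen set [C] of forbidden configurations defines. *)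
Definition avoid (C : set (config M S)) : set (config M S) :=
  [set x | forall m, ~ C (shift_act m x)].

Lemma avoid_closed C : open C -> closed (avoid C).
Proof.
move=> oC; have -> : avoid C = \bigcap_m (shift_act m @^-1` (~` C)).
  by apply/seteqP; split=> x xC m; [move=> _; exact: xC|exact: (xC m I)].
apply: closed_bigI => m _.
apply: ((continuous_closedP _).1 (@shift_act_continuous m)).
exact: open_closedC.
Qed.

Lemma avoid_invariant C m x : avoid C x -> avoid C (shift_act m x).
Proof. by move=> xC n; rewrite -shift_actM; exact: xC. Qed.

Lemma avoid_subshift (C : set (config M S)) : clopen C ->
  exists2 Z : subshift M S, SFT Z & subshift_set Z = avoid C.
Proof.
move=> cC; exists (Subshift (avoid_closed cC.1) (@avoid_invariant C)) => //.
by exists C.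
Qed.

Lemma closure_invariant (A : set (config M S)) :
    (forall m x, A x -> A (shift_act m x)) ->
  forall m x, closure A x -> closure A (shift_act m x).
Proof.
move=> invA m x Ax U /(@shift_act_continuous m x)/Ax[y [Ay Uy]].
by exists (shift_act m y); split=> //; exact: invA.
Qed.

Lemma subshift_compact (Y : subshift M S) : compact [set: Y].
Proof.
apply: compact_set_type; apply: subclosed_compact config_compact _ => //.
exact: subshift_closed.
Qed.

Lemma subshift_valP (Y : subshift M S) (y : Y) : subshift_set Y (val y).
Proof. exact: set_valP. Qed.

Lemma subshift_in (Y : subshift M S) x : subshift_set Y x ->
  exists y : Y, val y = x.
Proof. by move=> Yx; exists (SigSub (mem_set Yx)). Qed.

Lemma subshift_val_continuous (Y : subshift M S) :
  continuous (fun y : Y => val y : config M S).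
Proof. exact: initial_continuous. Qed.

End Config.

Section Square.
Variables (M : monoidType) (S : finType).

Lemma pair_config_inj (x y x' y' : config M S) :
  pair_config x y = pair_config x' y' -> x = x' /\ y = y'.
Proof.
by move=> e; split; apply/funext => m; have := congr1 (@^~ m) e => -[].
Qed.

Lemma pair_configK (p : config M (S * S)%type) :
  pair_config (fun m => (p m).1) (fun m => (p m).2) = p.
Proof. by apply/funext => m; rewrite /pair_config -surjective_pairing. Qed.

Lemma square_val (Y : subshift M S) (p : config M (S * S)%type) : square Y p ->
  exists y y' : Y, p = pair_config (val y) (val y').
Proof.
move=> [/subshift_in[y yp] /subshift_in[y' yp']].
by exists y, y'; rewrite yp yp' pair_configK.
Qed.

Lemma pair_config_continuous (Y : subshift M S) :
  continuous (fun p : Y * Y => pair_config (val p.1) (val p.2)).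
Proof.
apply: config_continuous => m [y y'].
have h (z : Y) : nbhs z [set u : Y | val u m = val z m].
  exact: (subshift_val_continuous (config_coord_nbhs (val z) m)).
exists ([set u : Y | val u m = val y m], [set u : Y | val u m = val y' m]).
  by split; exact: h.
by move=> [u u'] [/= uy uy']; rewrite /pair_config uy uy'.
Qed.

Lemma square_subshift (Y : subshift M S) :
  exists Q : subshift M (S * S)%type, subshift_set Q = square Y.
Proof.
have cont (f : S * S -> S) :
    continuous (fun p : config M (S * S)%type => (fun m => f (p m)) : config M S).
  apply: config_continuous => m p.
  by apply: (@filterS _ _ _ _ _ _ (config_coord_nbhs p m)) => q /= ->.
have cQ : closed (square Y).
  have cY f := (continuous_closedP _).1 (cont f) _ (@subshift_closed _ _ Y).
  exact: closedI (cY fst) (cY snd).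
have invQ m p : square Y p -> square Y (shift_act m p).
  move=> [Y1 Y2]; split; first exact: (subshift_invariant m Y1).
  exact: (subshift_invariant m Y2).
by exists (Subshift cQ invQ).
Qed.

Lemma subshiftI (Z Z' : subshift M S) :
  exists Q : subshift M S, subshift_set Q = subshift_set Z `&` subshift_set Z'.
Proof.
have cQ := closedI (@subshift_closed _ _ Z) (@subshift_closed _ _ Z').
have invQ m p : (Z `&` Z') p -> (Z `&` Z') (shift_act m p).
  by move=> [? ?]; split; exact: subshift_invariant.
by exists (Subshift cQ invQ).
Qed.

End Square.

(** * Quotients of subshifts as factor maps *)

Section FactorMaps.
Variables (M : monoidType) (X : topologicalType) (act : M -> X -> X).
Variables (S : finType) (Y : subshift M S) (Z : subshift M (S * S)%type).

(** [pi] is a continuous equivariant surjection from the subshift [Y] onto [X]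
    whose kernel is the relation that [Z] induces on [Y]. *)
Definition factor_map (pi : Y -> X) : Prop :=
  [/\ continuous pi, forall m y, pi (subshift_act m y) = act m (pi y),
      forall x, exists y, pi y = x &
      forall y y', rel_in Y Z y y' <-> pi y = pi y'].

(** Since subshifts are compact, a continuous bijection from the quotient onto a
    Hausdorff space is automatically a homeomorphism. *)
Lemma conjugate_to_quotientP : hausdorff_space X ->
  conjugate_to_quotient act Y Z <-> exists pi, factor_map pi.
Proof.
move=> hX; split=> [[eqZ [h [g [hK gK ch cg hact]]]]|[pi [cpi pact psurj pker]]].
  exists (g \o quotient_class eqZ); split.
  - move=> y; apply: continuous_comp; last exact: cg.
    exact: pi_continuous.
  - move=> m y /=; rewrite -quotient_actE.
    by apply: (can_inj hK); rewrite gK hact gK.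
  - move=> x; exists (repr (h x : {eq_quot equiv_in eqZ})) => /=.
    by rewrite /quotient_class reprK hK.
  - move=> y y' /=; rewrite -(quotient_classP eqZ); split=> [->//|].
    exact: (can_inj gK).
have eqZ : RelationClasses.Equivalence (rel_in Y Z).
  split=> [y|y y' /pker yy'|y y' y'' /pker e /pker e']; apply/pker => //.
  by rewrite e.
exists eqZ; pose lift x := projT1 (cid (psurj x)).
have liftK x : pi (lift x) = x by exact: (projT2 (cid (psurj x))).
pose h x := quotient_class eqZ (lift x).
pose g (q : quotient_space eqZ) := pi (repr (q : {eq_quot equiv_in eqZ})).
have gE y : g (quotient_class eqZ y) = pi y.
  apply/pker/(quotient_classP eqZ).
  by rewrite /quotient_class reprK.
have hK : cancel h g by move=> x; rewrite gE liftK.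
have gK : cancel g h.
  move=> q; rewrite -[q](@reprK _ {eq_quot equiv_in eqZ}).
  rewrite -/(quotient_class eqZ _) gE.
  by apply/quotient_classP/pker; rewrite liftK.
have cg : continuous g.
  apply: repr_comp_continuous => // y y' /eqP yy'.
  by apply/eqP/pker/(quotient_classP eqZ).
exists h, g; split=> //.
- apply: compact_hausdorff_inverse_continuous cg gK hK => //.
  have -> : [set: quotient_space eqZ] = quotient_class eqZ @` [set: Y].
    apply/seteqP; split=> // q _.
    by exists (repr (q : {eq_quot equiv_in eqZ})) => //; exact: reprK.
  apply: continuous_compact (@subshift_compact _ _ Y).
  by apply: continuous_subspaceT; exact: pi_continuous.
- move=> m x; rewrite quotient_actE; apply/quotient_classP/pker.
  by rewrite liftK pact liftK.
Qed.

End FactorMaps.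

(** * Expansivity and relative SFTs *)

Section ExpansiveSFT.
Variables (R : realType) (M : monoidType) (X : topologicalType).
Variables (act : M -> X -> X) (d : X -> X -> R).
Hypothesis cd : compatible_metric d.

Lemma compact_metric_bounded_below (T : topologicalType) (K : set T)
    (f g : T -> X) :
    compact K -> continuous f -> continuous g -> (forall t, K t -> f t <> g t) ->
  exists2 e : R, 0 < e & forall t, K t -> e < d (f t) (g t).
Proof.
move=> /compact_near_coveringP cK cf cg fg.
(* [F] contains a set as soon as all reals below some [e > 0] belong to it. *)
pose F : set_system R :=
  filter_from [set e | 0 < e] (fun e => [set e' | e' <= e]).
have FF : Filter F.
  apply: filter_from_filter; first by exists 1; exact: ltr01.
  move=> e e' /= e0 e'0; exists (Num.min e e').
    by rewrite /= lt_min e0.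
  by move=> r /=; rewrite le_min => /andP.
have [|e e0 eP] := cK _ F (fun e t => e < d (f t) (g t)) FF; last first.
  by exists e => // t; apply: (eP e) => /=.
move=> t Kt; have d0 : 0 < d (f t) (g t) / 2.
  rewrite divr_gt0// lt_neqAle (metric_ge0 cd) andbT eq_sym; apply/eqP.
  by move=> /(metric_positivity cd.1); exact: fg.
have [[U V] /= [Uf Vg] UV] := metric_near cd (f t) (g t) d0.
exists (f @^-1` U `&` g @^-1` V, [set e | e <= d (f t) (g t) / 2]).
  split; last by exists (d (f t) (g t) / 2).
  by apply: filterI; [exact: cf|exact: cg].
move=> [u e] [/= [Uu Vu] eu].
by have := UV (f u, g u) (conj Uu Vu); rewrite /= ltr_norml => /andP[]; lra.
Qed.

Lemma metric_le_closed (T : topologicalType) (f g : T -> X) (e : R) :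
  continuous f -> continuous g -> closed [set t | d (f t) (g t) <= e].
Proof.
move=> cf cg; rewrite -openC openE => t /= /negP; rewrite -ltNge => et.
have r0 : 0 < d (f t) (g t) - e by rewrite subr_gt0.
have [[U V] /= [Uf Vg] UV] := metric_near cd (f t) (g t) r0.
apply: (@filterS _ _ _ (f @^-1` U `&` g @^-1` V)).
  move=> u [Uu Vu]; apply/negP; rewrite -ltNge.
  by have := UV (f u, g u) (conj Uu Vu); rewrite /= ltr_norml => /andP[]; lra.
by apply: filterI; [exact: cf|exact: cg].
Qed.

Lemma metric_ge_closed (T : topologicalType) (f g : T -> X) (e : R) :
  continuous f -> continuous g -> closed [set t | e <= d (f t) (g t)].
Proof.
move=> cf cg; rewrite -openC openE => t /= /negP; rewrite -ltNge => et.
have r0 : 0 < e - d (f t) (g t) by rewrite subr_gt0.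
have [[U V] /= [Uf Vg] UV] := metric_near cd (f t) (g t) r0.
apply: (@filterS _ _ _ (f @^-1` U `&` g @^-1` V)).
  move=> u [Uu Vu]; apply/negP; rewrite -ltNge.
  by have := UV (f u, g u) (conj Uu Vu); rewrite /= ltr_norml => /andP[]; lra.
by apply: filterI; [exact: cf|exact: cg].
Qed.

Variables (S : finType) (Y : subshift M S) (Z : subshift M (S * S)%type).
Variable pi : Y -> X.
Hypothesis pi_factor : factor_map act Z pi.

Let pair_val (p : Y * Y) : config M (S * S)%type :=
  pair_config (val p.1) (val p.2).

Let pi_fst_continuous : continuous (fun p : Y * Y => pi p.1).
Proof.
case: pi_factor => cpi _ _ _ p.
by apply: (@continuous_comp _ _ _ fst pi); [exact: cvg_fst|exact: cpi].
Qed.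

Let pi_snd_continuous : continuous (fun p : Y * Y => pi p.2).
Proof.
case: pi_factor => cpi _ _ _ p.
by apply: (@continuous_comp _ _ _ snd pi); [exact: cvg_snd|exact: cpi].
Qed.

Let compact_YY : compact [set: Y * Y].
Proof.
rewrite -setXTT; apply: compact_setX; exact: subshift_compact.
Qed.

Let compact_pair_val (K : set (Y * Y)) : closed K -> compact (pair_val @` K).
Proof.
move=> clK; apply: continuous_compact.
  apply: continuous_subspaceT; exact: pair_config_continuous.
exact: subclosed_compact compact_YY _.
Qed.

(** Let [C] be the clopen set of forbidden pairs. The pairs of points of [Y] that
    lie in [C] form a compact set on which the two images under [pi] differ, so
    their distance there is bounded below by some [e > 0]; two distinct points of
    [X] have preimages of which some translate is in [C]. *)
Lemma expansive_of_relative_SFT :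
  relative_SFT Y (Z `&` square Y) -> expansive R act.
Proof.
case: pi_factor => cpi pact psurj pker [Z' [C cC ZC] ZZ'].
have relP y y' : rel_in Y Z y y' <->
    forall m, ~ C (shift_act m (pair_val (y, y'))).
  rewrite -ZC; have sq : square Y (pair_val (y, y')).
    by split; exact: subshift_valP.
  have : (Z `&` square Y) (pair_val (y, y')) <->
         (Z' `&` square Y) (pair_val (y, y')) by rewrite ZZ'.
  by rewrite /rel_in /= => -[ZZ1 ZZ2]; split=> [z|z]; [case: ZZ1|case: ZZ2].
have clK : closed (pair_val @^-1` C).
  apply: ((continuous_closedP _).1 (@pair_config_continuous _ _ Y)).
  by case: cC.
have [|e e0 eK] := compact_metric_bounded_below
  (subclosed_compact clK compact_YY (@subsetT _ _))
  pi_fst_continuous pi_snd_continuous.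
  move=> [y y'] /= Cy /pker/relP /(_ 1%g).
  by rewrite shift_act1.
exists d => //; exists e => // x x' xx'.
have [y yx] := psurj x; have [y' yx'] := psurj x'.
have [m Cm] : exists m, C (shift_act m (pair_val (y, y'))).
  apply: contrapT => Cn; apply: xx'; rewrite -yx -yx'; apply/pker/relP => m Cm.
  by apply: Cn; exists m.
exists m; rewrite -yx -yx' -!pact.
exact: (eK (subshift_act m y, subshift_act m y')).
Qed.

(** Any clopen [C] that contains the pairs with images at distance at least [e]
    and misses the pairs with equal images can serve as the forbidden set. *)
Lemma relative_SFT_of_expansivity_constant (e : R) :
    0 < e ->
    (forall x y, x <> y -> exists m, e < d (act m x) (act m y)) ->
  relative_SFT Y (Z `&` square Y).
Proof.
case: pi_factor => cpi pact psurj pker e0 eact.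
pose far := [set p : Y * Y | e <= d (pi p.1) (pi p.2)].
pose ker := [set p : Y * Y | d (pi p.1) (pi p.2) <= 0].
have clfar : closed far by exact: metric_ge_closed.
have clker : closed ker by exact: metric_le_closed.
have kerP y y' : ker (y, y') <-> rel_in Y Z y y'.
  split=> [/= yy'|/pker yy']; last by rewrite /ker/= yy' (metric_xx cd.1).
  apply/pker/(metric_positivity cd.1)/eqP.
  by rewrite eq_le yy' (metric_ge0 cd).
have [|C cC [farC Cker]] := clopen_separation (@config_hausdorff M (S * S)%type)
    (@config_zero_dimensional M (S * S)%type) (@config_compact M (S * S)%type)
    (compact_pair_val clfar)
    (closed_openC (compact_closed (@config_hausdorff M (S * S)%type)
                                  (compact_pair_val clker))).
  move=> _ [[y y'] /= yy' <-] [[z z'] /= zz'].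
  rewrite /pair_val /= => /pair_config_inj[/val_inj ? /val_inj ?]; subst z z'.
  by move: (le_trans yy' zz'); rewrite leNgt e0.
have [Z' Z'SFT Z'E] := avoid_subshift cC.
exists Z' => //; apply/seteqP; split=> p [Zp sqp]; split=> //.
  rewrite Z'E => m Cm.
  have [y [y' pE]] := square_val sqp.
  apply: (Cker _ Cm); exists (subshift_act m y, subshift_act m y').
    apply/kerP/pker; rewrite !pact; congr (act m _); apply/pker.
    by rewrite /rel_in -pE.
  by rewrite pE.
have [y [y' pE]] := square_val sqp.
rewrite pE; apply/pker; apply: contrapT => /eact[m em].
have : avoid C p by rewrite -Z'E.
move=> /(_ m); apply; apply: farC.
exists (subshift_act m y, subshift_act m y'); last by rewrite pE.
by rewrite /far /= !pact ltW.
Qed.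

End ExpansiveSFT.

(** * Coding by closed covers *)

Section Coding.
Variables (M : monoidType) (X : topologicalType) (act : M -> X -> X).
Hypothesis actM : forall m n x, act (m * n)%g x = act m (act n x).
Hypothesis act_continuous : forall m, continuous (act m).
Hypothesis X_compact : compact [set: X].
Variables (S : finType) (K : S -> set X).
Hypothesis K_closed : forall a, closed (K a).

(** [y] records, at each [m], an element of the closed family [K] that contains
    [act m x]; where the [K a] meet, a point may have several codes. *)
Definition codes (y : config M S) (x : X) : Prop :=
  forall m, K (y m) (act m x).

(** The pair configuration [p] only uses pairs of letters whose closed sets meet.
    This is a condition on one coordinate at a time, hence of finite type. *)
Definition overlapping (p : config M (S * S)%type) : Prop :=
  forall m, (K (p m).1 `&` K (p m).2) !=set0.

Hypothesis overlapping_eq : forall y y' x x',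
  overlapping (pair_config y y') -> codes y x -> codes y' x' -> x = x'.

Lemma codes_unique y x x' : codes y x -> codes y x' -> x = x'.
Proof.
move=> yx yx'; apply: overlapping_eq (yx) yx' => m.
by exists (act m x); split; exact: yx.
Qed.

Lemma codes_shift m y x : codes y x -> codes (shift_act m y) (act m x).
Proof. by move=> yx n; rewrite -actM; exact: yx. Qed.

Lemma not_codes_near y x : ~ codes y x ->
  \forall x' \near x & y' \near y, ~ codes y' x'.
Proof.
move=> /existsNP[m nK].
exists (act m @^-1` (~` K (y m)), [set y' : config M S | y' m = y m]).
  split; last exact: config_coord_nbhs.
  apply: act_continuous; apply: open_nbhs_nbhs; split=> //.
  exact/closed_openC.
by move=> [x' y'] [/= nKx' y'm] /(_ m); rewrite y'm.
Qed.

Lemma coded_closed : closed [set y | exists x, codes y x].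
Proof.
rewrite -openC openE => y /= ny.
have H : \forall y' \near y, forall x, [set: X] x -> ~ codes y' x.
  apply: compact_near_all => // x _.
  by apply: not_codes_near => yx; apply: ny; exists x.
by apply: filterS H => y' nall [x /(nall x I)].
Qed.

Lemma coded_points_closed (Y : subshift M S) :
  closed [set x | exists2 y, subshift_set Y y & codes y x].
Proof.
rewrite -openC openE => x /= nx.
have cY : compact (subshift_set Y).
  by apply: subclosed_compact (@config_compact M S) _ => //; exact: subshift_closed.
have H : \forall x' \near x, forall y, subshift_set Y y -> ~ codes y x'.
  apply: compact_near_all => // y Yy.
  have /not_codes_near[[U V] /= [Ux Vy] UV] : ~ codes y x.
    by move=> yx; apply: nx; exists y.
  by exists (V, U) => // -[y' x'] [/= Vy' Ux']; exact: (UV (x', y')).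
by apply: filterS H => x' nall [y Yy /(nall y Yy)].
Qed.

(** A subshift of codes that reaches every point factors onto [X], with kernel the
    overlapping pairs. The factor map has a closed graph and a compact target,
    which makes it continuous. *)
Lemma coding_factor_map (Y : subshift M S) (Z : subshift M (S * S)%type) :
    (forall y, subshift_set Y y -> exists x, codes y x) ->
    (forall x, exists2 y, subshift_set Y y & codes y x) ->
    (forall y y' : Y, rel_in Y Z y y' <->
                      overlapping (pair_config (val y) (val y'))) ->
  exists2 pi : Y -> X, factor_map act Z pi & forall y, codes (val y) (pi y).
Proof.
move=> Ycoded Xcoded ZE.
have /choice[pi piP] : forall y : Y, exists x, codes (val y) x.
  by move=> y; apply: Ycoded; exact: subshift_valP.
exists pi => //; split.
- move=> y U Uy.
  have clU : compact (~` U°).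
    by apply: subclosed_compact X_compact _ => //; apply/open_closedC/open_interior.
  have H : \forall y' \near y, forall x, (~` U°) x -> ~ codes (val y') x.
    apply: compact_near_all => // x nUx.
    have /not_codes_near[[V W] /= [Vx Wy] VW] : ~ codes (val y) x.
      move=> yx; apply: nUx; rewrite -(codes_unique (piP y) yx).
      exact: Uy.
    exists (V, (fun y : Y => val y : config M S) @^-1` W).
      by split=> //=; exact: subshift_val_continuous.
    by move=> [x' y'] [/= Vx' Wy']; exact: (VW (x', val y')).
  apply: (@filterS _ _ (nbhs_filter y) _ _ _ H) => y' nall.
  suff : U° (pi y') by exact: interior_subset.
  apply: contrapT => nUy'.
  exact: nall nUy' (piP y').
- move=> m y; apply: codes_unique (piP _) _.
  exact/codes_shift/piP.
- move=> x; have [_ /subshift_in[y <-] yx] := Xcoded x.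
  by exists y; exact: codes_unique (piP y) yx.
- move=> y y'; rewrite ZE; split=> [yy'|yy' m].
    exact: overlapping_eq yy' (piP y) (piP y').
  exists (act m (pi y)); split; first exact: piP.
  by rewrite yy'; exact: piP.
Qed.

Lemma overlapping_SFT : exists2 Z : subshift M (S * S)%type,
  SFT Z & forall p, subshift_set Z p <-> overlapping p.
Proof.
have cC := config_coord_clopen (M := M)
  [set a : S * S | ~ ((K a.1 `&` K a.2) !=set0)] 1%g.
have [Z ZSFT ZE] := avoid_subshift cC.
exists Z => // p; rewrite ZE; split=> pZ m.
  by apply: contrapT => nK; apply: (pZ m); rewrite /= /shift_act mul1g.
by rewrite /= /shift_act mul1g => /(_ (pZ m)).
Qed.

Lemma full_coding_subshift : exists Y : subshift M S,
  subshift_set Y = [set y | exists x, codes y x].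
Proof.
have invY m y : [set y | exists x, codes y x] y ->
    [set y | exists x, codes y x] (shift_act m y).
  by move=> [x yx]; exists (act m x); exact: codes_shift.
by exists (Subshift coded_closed invY).
Qed.

Lemma cover_codes : (forall x, exists a, K a x) -> forall x, exists y, codes y x.
Proof.
move=> Kcov x; have /choice[y yP] : forall m, exists a, K a (act m x) by [].
by exists y.
Qed.

End Coding.

Section SmallCover.
Variables (R : realType) (X : topologicalType) (d : X -> X -> R).
Hypothesis cd : compatible_metric d.
Hypothesis X_compact : compact [set: X].

(** Removing from each ball of a finite cover the closures of the earlier ones
    leaves disjoint open sets whose union is still dense. *)
Lemma small_open_tiling (e : R) : 0 < e ->
  exists (S : finType) (U : S -> set X),
  [/\ forall a, open (U a),
      forall a b, a != b -> U a `&` closure (U b) = set0,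
      dense (\bigcup_a U a),
      forall x, exists a, closure (U a) x &
      forall a b x y, (closure (U a) `&` closure (U b)) !=set0 ->
        closure (U a) x -> closure (U b) y -> d x y <= e].
Proof.
move=> e0; have e4 : 0 < e / 4 by rewrite divr_gt0.
have [s sP] := compact_finite_balls cd X_compact e4.
pose c (i : 'I_(size s)) := tnth (in_tuple s) i.
pose B i := [set x | d (c i) x < e / 4].
pose U i := B i `&`
  ~` \bigcup_(j in [set j : 'I_(size s) | (j < i)%N]) closure (B j).
have cB i : closure (U i) `<=` [set x | d (c i) x <= e / 4].
  rewrite [X in _ `<=` X](closure_id _).1; last exact: metric_closed_ball_closed.
  by apply: closureS => x [/ltW].
have oB i : open (B i) by exact: metric_ball_open.
have oU i : open (U i).
  apply: openI => //; apply: closed_openC.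
  apply: closed_bigcup => [|j _]; last exact: closed_closure.
  exact: finite_finset.
have disj i j : i != j -> U i `&` U j = set0.
  wlog ij : i j / (i < j)%N.
    move=> W ij; have := ij; rewrite neq_ltn => /orP[/W|/W]; first exact.
    by rewrite setIC; apply; rewrite eq_sym.
  move=> _; rewrite -subset0 => x [[Bx _] [_ nBx]]; apply: nBx.
  by exists i => //; exact: subset_closure.
have dU : dense (\bigcup_i U i).
  move=> O [x Ox] oO.
  (* For the least [i] whose ball meets [O], [O] misses the closures of all the
     earlier balls. *)
  pose P i := `[< (O `&` B i) !=set0 >].
  have [i0 Pi0] : exists i, P i.
    have [z /(nthP x)[k ks kz] dz] := sP x.
    exists (Ordinal ks); apply/asboolP; exists x; split=> //.
    by rewrite /B /c /= (tnth_nth x) /= kz.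
  case: (arg_minnP (fun i : 'I_(size s) => nat_of_ord i) Pi0).
  move=> i /asboolP[y [Oy By]] imin.
  exists y; split=> //; exists i => //; split=> // -[j /= ji].
  move=> /(_ O) [|z [Bz Oz]]; first by apply: open_nbhs_nbhs.
  have : (i <= j)%N by apply: imin; apply/asboolP; exists z.
  by rewrite leqNgt ji.
exists 'I_(size s), U; split=> //.
- move=> a b ab; rewrite -subset0 => x [Uax /(_ (U a))].
  case; first by apply: open_nbhs_nbhs.
  move=> y [Uby Uay]; have : (U a `&` U b) y by [].
  by rewrite disj.
- move=> x; suff [i _ Ux] : (\bigcup_i closure (U i)) x by exists i.
  apply: contrapT => nx; have oN : open (~` \bigcup_i closure (U i)).
    apply: closed_openC; apply: closed_bigcup => [|i _].
      exact: finite_finset.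
    exact: closed_closure.
  have [|z [nz [i _ Uz]]] := dU _ _ oN; first by exists x.
  by apply: nz; exists i => //; exact: subset_closure.
- move=> a b x y [z [/cB za /cB zb]] /cB xa /cB yb.
  rewrite /= in za zb xa yb.
  have := metric_triangular cd.1 z x y.
  have := metric_triangular cd.1 (c a) x z.
  have := metric_triangular cd.1 (c b) z y.
  rewrite (metric_symmetric cd.1 x (c a)) (metric_symmetric cd.1 z (c b)).
  lra.
Qed.

End SmallCover.

(** * Itineraries of generic points, for a group action *)

Section GenericCoding.
Variables (M : monoidType) (X : topologicalType) (act : M -> X -> X).
Hypothesis act1 : forall x, act 1%g x = x.
Hypothesis actM : forall m n x, act (m * n)%g x = act m (act n x).
Hypothesis act_continuous : forall m, continuous (act m).
Hypothesis M_group : is_group M.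
Variables (S : finType) (U : S -> set X).
Hypothesis U_open : forall a, open (U a).
Hypothesis U_dense : dense (\bigcup_a U a).

(** The codes of the points whose orbit stays in the open set [\bigcup_a U a]. *)
Definition itineraries : set (config M S) :=
  [set y | exists x, forall m, U (y m) (act m x)].

Lemma itineraries_invariant m y :
  itineraries y -> itineraries (shift_act m y).
Proof. by move=> [x yx]; exists (act m x) => n; rewrite -actM; exact: yx. Qed.

Lemma itinerary_subshift : exists Y : subshift M S,
  subshift_set Y = closure itineraries.
Proof.
by exists (Subshift (@closed_closure _ itineraries)
                    (closure_invariant itineraries_invariant)).
Qed.

(** Each [act m] is a homeomorphism, so it pulls dense sets back to dense sets. *)
Lemma group_act_dense m : dense (act m @^-1` \bigcup_a U a).
Proof.
move=> O [x Ox] oO; have [m' [mm' m'm]] := M_group m.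
have [||z [Oz Uz]] := U_dense (O := act m' @^-1` O).
- by exists (act m x); rewrite /= -actM m'm act1.
- exact: open_comp.
by exists (act m' z); split=> //=; rewrite -actM mm' act1.
Qed.

Lemma itinerary_points_dense (R : realType) (d : X -> X -> R) :
    compatible_metric d -> compact [set: X] -> countable [set: M] ->
  dense [set x | exists y : config M S, forall m, U (y m) (act m x)].
Proof.
move=> cd cX /countable_injP[f f_inj].
have [e eP] : exists e : nat -> M, forall m, exists n, e n = m.
  have /choice[e eP] : forall n, exists m, forall m', f m' = n -> m = m'.
    move=> n; have [[m fm]|nm] := pselect (exists m, f m = n).
      by exists m => m' fm'; apply: f_inj; rewrite ?inE// fm.
    by exists 1%g => m' fm'; case: nm; exists m'.
  by exists e => m; exists (f m); exact: eP.
have dI : dense (\bigcap_n act (e n) @^-1` \bigcup_a U a).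
  apply: compact_metric_Baire cd cX _ _ => n.
    by apply: open_comp => //; exact: bigcup_open.
  exact: group_act_dense.
move=> O O0 oO; have [x [Ox xU]] := dI O O0 oO.
exists x; split=> //.
have /choice[y yP] : forall m, exists a, U a (act m x).
  by move=> m; have [n <-] := eP m; have [a _ Ua] := xU n I; exists a.
by exists y.
Qed.

End GenericCoding.

(** * Characterisations of expansivity *)

Section Expansive.
Variables (R : realType) (M : monoidType) (X : topologicalType).
Variable act : M -> X -> X.
Hypothesis sysX : dynamical_system R act.

(** The tiling of [X] has tiles so small that, by expansivity, the closures of the
    tiles visited by an orbit determine the point, even up to overlap. *)
Lemma expansive_coding : expansive R act ->
  exists (S : finType) (U : S -> set X),
  [/\ forall a, open (U a),
      forall a b, a != b -> U a `&` closure (U b) = set0,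
      dense (\bigcup_a U a),
      forall x, exists a, closure (U a) x &
      forall y y' x x',
        @overlapping M _ S (closure \o U) (pair_config y y') ->
        codes act (closure \o U) y x -> codes act (closure \o U) y' x' ->
        x = x'].
Proof.
move=> [d cd [e e0 eP]].
have [S [U [oU dU denseU covU smallU]]] := small_open_tiling cd (ds_compact sysX) e0.
exists S, U; split=> // y y' x x' yy' yx yx'.
apply: contrapT => /eP[m]; rewrite ltNge => /negP; apply.
exact: smallU (yy' m) (yx m) (yx' m).
Qed.

Let X_hausdorff : hausdorff_space X.
Proof. by case: (ds_metrizable sysX) => d; exact: metric_hausdorff. Qed.

Lemma expansive_subshift_SFT : expansive R act ->
  exists (S : finType) (Y : subshift M S) (Z : subshift M (S * S)%type),
    SFT Z /\ conjugate_to_quotient act Y Z.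
Proof.
case: (sysX) => cX _ act1 actM actC.
move=> /expansive_coding[S [U [_ _ _ covU UE]]].
have clU a : closed ((closure \o U) a) by exact: closed_closure.
have [Y YE] := full_coding_subshift actM actC cX clU.
have [Z ZSFT ZE] := @overlapping_SFT M X S (closure \o U).
exists S, Y, Z; split=> //; apply/(conjugate_to_quotientP _ _ _ X_hausdorff).
have [|||pi piF _] := coding_factor_map actM actC cX clU UE (Y := Y) (Z := Z).
- by move=> y; rewrite YE.
- move=> x; have [y yx] := cover_codes act covU x.
  by exists y => //; rewrite YE; exists x.
- by move=> y y'; exact: ZE.
- by exists pi.
Qed.

Lemma expansive_iff_relative_SFT (S : finType) (Y : subshift M S)
    (Z : subshift M (S * S)%type) :
  conjugate_to_quotient act Y Z ->
  expansive R act <-> relative_SFT Y (Z `&` square Y).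
Proof.
move=> /(conjugate_to_quotientP _ _ _ X_hausdorff)[pi piF]; split.
  move=> [d cd [e e0 eP]].
  exact: (relative_SFT_of_expansivity_constant cd piF e0 eP).
have [d cd] := ds_metrizable sysX.
exact: (expansive_of_relative_SFT cd piF).
Qed.

(** For a group, [Y] is the closure of the itineraries of generic points. If two
    points of [Y] have the same image in [X], the orbit of that image leaves the
    open tiles at some [m]. For fixed [m], the points of [Y] whose image does so
    form a closed set [G m], which has empty interior because it contains no
    itinerary while the itineraries are dense in [Y]. *)
Lemma group_expansive_meager : countable [set: M] -> is_group M ->
  expansive R act ->
  exists (S : finType) (Y : subshift M S) (Z : subshift M (S * S)%type),
    [/\ relative_SFT Y Z, conjugate_to_quotient act Y Z &
        meager [set y : Y | exists2 y' : Y, y' <> y & rel_in Y Z y y']].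
Proof.
move=> cM gM; case: (sysX) => cX [d cd] act1 actM actC.
move=> /expansive_coding[S [U [oU disjU denseU covU UE]]].
have clU a : closed ((closure \o U) a) by exact: closed_closure.
have itin_codes y x : (forall m, U (y m) (act m x)) ->
    codes act (closure \o U) y x.
  by move=> yx m; apply: subset_closure; exact: yx.
have [Y YE] := itinerary_subshift actM U.
have [Z0 Z0SFT Z0E] := @overlapping_SFT M X S (closure \o U).
have [Q QE] := square_subshift Y.
have [Z ZE] := subshiftI Z0 Q.
have relE (y y' : Y) : rel_in Y Z y y' <->
    overlapping (closure \o U) (pair_config (val y) (val y')).
  rewrite /rel_in ZE QE -Z0E; split=> [[]//|yy']; split=> //.
  by split; exact: subshift_valP.
have [||pi piF piP] :=
  coding_factor_map actM actC cX clU UE (Y := Y) (Z := Z) _ _ relE.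
- move=> y; have clc := coded_closed (act := act) actC cX clU.
  rewrite YE -[X in _ -> X]/([set y | exists x, codes act (closure \o U) y x] y).
  rewrite ((closure_id _).1 clc); apply: closureS.
  by move=> z [x zx]; exists x; exact: itin_codes.
- have closedP := coded_points_closed (act := act) actC clU (Y := Y).
  move=> x; apply: contrapT => nx.
  have [|z [nz [y yz]]] := itinerary_points_dense act1 actM actC gM oU denseU
    cd cX cM _ (closed_openC closedP); first by exists x.
  apply: nz; exists y; last exact: itin_codes.
  by rewrite YE; apply: subset_closure; exists z.
exists S, Y, Z; split.
- by exists Z0 => //; rewrite ZE QE.
- by apply/(conjugate_to_quotientP _ _ _ X_hausdorff); exists pi.
have [cpi pact psurj pker] := piF.
pose A := [set y : Y | exists2 y' : Y, y' <> y & rel_in Y Z y y'].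
pose G m := [set y : Y | forall a, ~ U a (act m (pi y))].
have G_closed m : closed (G m).
  have -> : G m = ~` (pi @^-1` (act m @^-1` \bigcup_a U a)).
    apply/seteqP; split=> y /=; first by move=> Gy [a _]; exact: Gy.
    by move=> Gy a Ua; apply: Gy; exists a.
  apply: open_closedC; apply: open_comp => [y _|]; first exact: cpi.
  apply: open_comp => [y _|]; first exact: actC.
  exact: bigcup_open.
have G_nowhere_dense m : nowhere_dense (G m).
  rewrite /nowhere_dense -(closure_id _).1// -subset0 => y [_ [[W oW <-] /= Wy WG]].
  have /(_ W)[|z [[x zx] Wz]] : closure (itineraries act U) (val y).
  - by have := @subshift_valP _ _ Y y; move: (val y) => v; rewrite YE.
    by apply: open_nbhs_nbhs.
  have [|z' z'E] := @subshift_in _ _ Y z.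
    by rewrite YE; apply: subset_closure; exists x.
  have pz' : pi z' = x.
    apply: (codes_unique UE) (piP z') _; rewrite z'E; exact: itin_codes.
  apply: (WG z' _ (z m)); first by move: Wz; rewrite -z'E.
  by rewrite pz'; exact: zx.
have AG y : A y -> exists m, G m y.
  move=> [y' y'y /pker yy']; apply: contrapT => nG; apply: y'y.
  apply/val_inj/funext => m.
  have [a Ua] : exists a, U a (act m (pi y)).
    by apply: contrapT => nU; apply: nG; exists m => a Ua; apply: nU; exists a.
  (* The open tile [U a] meets no other closed tile: it fixes the letter at [m]. *)
  have only (z : Y) : pi z = pi y -> val z m = a.
    move=> zy; apply/eqP; apply: contrapT => /negP; rewrite eq_sym => za.
    have : (U a `&` closure (U (val z m))) (act m (pi y)).
      by split=> //; rewrite -zy; exact: piP.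
    by rewrite disjU.
  by rewrite !only.
(* The sets [G m] are indexed by [nat] through the injection [f]; indices outside
   its range get the empty set. *)
have /countable_injP[f f_inj] := cM.
exists (fun n => [set y | A y /\ exists2 m, f m = n & G m y]).
  move=> n; rewrite /nowhere_dense -subset0.
  have [[m fm]|nm] := pselect (exists m, f m = n).
    rewrite -(G_nowhere_dense m); apply/interiorS/closureS => y [_ [m' fm' Gm']].
    by rewrite (f_inj m m') ?inE// fm fm'.
  rewrite (_ : [set _ | _] = set0) ?closure0 ?interior0//.
  by rewrite -subset0 => y [_ [m fm _]]; apply: nm; exists m.
apply/seteqP; split=> y; last by move=> [n _ []].
by move=> Ay; have [m Gm] := AG y Ay; exists (f m) => //; split=> //; exists m.
Qed.

End Expansive.

Theorem theorem1p3 (R : realType) (M : monoidType) (X : topologicalType)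
    (act : M -> X -> X) (countM : countable [set: M])
    (sysX : dynamical_system R act) :
  [/\ expansive R act <->
      (exists (S : finType) (Y : subshift M S) (Z : subshift M (S * S)%type),
          SFT Z /\ conjugate_to_quotient act Y Z),
      expansive R act <->
      ((exists (S : finType) (Y : subshift M S) (Z : subshift M (S * S)%type),
           conjugate_to_quotient act Y Z) /\
       (forall (S : finType) (Y : subshift M S) (Z : subshift M (S * S)%type),
           conjugate_to_quotient act Y Z ->
           relative_SFT Y (Z `&` square Y))) &
      is_group M ->
      (expansive R act <->
       exists (S : finType) (Y : subshift M S) (Z : subshift M (S * S)%type),
         [/\ relative_SFT Y Z, conjugate_to_quotient act Y Z &
             meager [set y : Y | exists2 y' : Y, y' <> y & rel_in Y Z y y']])].
Proof.
split.
- split; first exact: expansive_subshift_SFT.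
  move=> [S [Y [Z [ZSFT XYZ]]]].
  by apply/(expansive_iff_relative_SFT sysX XYZ); exists Z.
- split=> [expX|[[S [Y [Z XYZ]]] relSFT]].
    split=> [|S Y Z XYZ].
      have [S [Y [Z [_ XYZ]]]] := expansive_subshift_SFT sysX expX.
      by exists S, Y, Z.
    exact/(expansive_iff_relative_SFT sysX XYZ).
  exact/(expansive_iff_relative_SFT sysX XYZ)/relSFT.
- move=> gM; split; first exact: group_expansive_meager.
  move=> [S [Y [Z [[Z' Z'SFT ZE] XYZ _]]]].
  apply/(expansive_iff_relative_SFT sysX XYZ); exists Z' => //.
  by rewrite ZE -setIA setIid.
Qed.
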